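(* Let $p$ be a prime, $s,n\ge1$ integers, $M=\lfloor p^s/2\rfloor$, and let $\pi^{(0)}=(n,0,\dots,0),\pi^{(1)},\dots,\pi^{(D-1)}$ be the Lee decompositions of elements of $(\mathbb{Z}/p^s\mathbb{Z})^n$. Let $d$ be the minimum Lee distance of some nonzero linear code in $(\mathbb{Z}/p^s\mathbb{Z})^n$, and let $B(n,d)$ be the maximum number of codewords of a linear code of length $n$ over $\mathbb{Z}/p^s\mathbb{Z}$ with minimum Lee distance $d$. Then $$B(n,d)\le\max\sum_{i=0}^{D-1}A_i,$$ where the maximum is over all real tuples $(A_0,\dots,A_{D-1})$ such that (i) $A_0=1$; (ii) $A_i\ge0$ for all $1\le i\le D-1$, and $A_i=0$ for all $i\in I$, where $I=\{i\ge1:\text{there is }x\in(\mathbb{Z}/p^s\mathbb{Z})^n\text{ with }\pi(x)=\pi^{(i)}\text{ and }\mathrm{wt}_{\mathsf L}(x)<d\}$; (iii) $A_i=A_j$ whenever $\pi^{(j)}\in S(\pi^{(i)})$; (iv) for all $0\le j\le D-1$, $$\sum_{i=1}^{D-1}A_i\,K^{\mathsf L}_{\pi^{(j)}}(\pi^{(i)})\ \ge\ \begin{cases}-\binom{n}{\pi^{(j)}_0,\dots,\pi^{(j)}_M}\,2^{\,n-\pi^{(j)}_0-\pi^{(j)}_M}&\text{if }p=2,\\[1mm]-\binom{n}{\pi^{(j)}_0,\dots,\pi^{(j)}_M}\,2^{\,n-\pi^{(j)}_0}&\text{otherwise.}\end{cases}$$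
   Context: A linear code is a $\mathbb{Z}/p^s\mathbb{Z}$-submodule of $(\mathbb{Z}/p^s\mathbb{Z})^n$. The Lee weight of $a\in\{0,\dots,p^s-1\}$ is $\mathrm{wt}_{\mathsf L}(a)=\min\{a,p^s-a\}$, extended additively to tuples; the minimum Lee distance of a nonzero linear code is the minimum Lee weight of its nonzero codewords. The Lee decomposition of $x\in(\mathbb{Z}/p^s\mathbb{Z})^n$ is $\pi(x)=(\pi_0,\dots,\pi_M)$ with $\pi_i=|\{k:x_k\in\{i,-i\}\}|$. The variable $A_i$ represents the number of codewords with Lee decomposition $\pi^{(i)}$. For a unit $u\in(\mathbb{Z}/p^s\mathbb{Z})^\times$, let $\sigma_u$ be the permutation of $\{1,\dots,M\}$ with $\sigma_u(i)=k$ where $uk\equiv\pm i\pmod{p^s}$. For a Lee decomposition $\pi$ put $\sigma_u(\pi)=(\pi_0,\pi_{\sigma_u(1)},\dots,\pi_{\sigma_u(M)})$ and $S(\pi)=\{\sigma_u(\pi):u\in(\mathbb{Z}/p^s\mathbb{Z})^\times\}$. Krawtchouk coefficient: with $\xi$ a primitive $p^s$-th root of unity, $K^{\mathsf L}_{\pi^{(j)}}(\pi^{(i)})=\sum_{x:\ \pi(x)=\pi^{(j)}}\xi^{\sum_ka_kx_k}$ for any $a\in(\mathbb{Z}/p^s\mathbb{Z})^n$ with $\pi(a)=\pi^{(i)}$ (independent of the choice of $a$). $\binom{n}{k_0,\dots,k_M}$ denotes the multinomial coefficient. *)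

(* Defs.v *)
From mathcomp Require Import all_boot all_order all_algebra.
From mathcomp Require Import boolp reals zify.
From mathcomp Require Export complex.

Set Implicit Arguments.
Unset Strict Implicit.
Unset Printing Implicit Defensive.

Import Order.TTheory GRing.Theory Num.Theory.

Local Open Scope ring_scope.

(* Throughout, q > 1 stands for p ^ s and 'Z_q for Z/qZ. *)

Definition lee_wt1 (q : nat) (a : 'Z_q) : nat := minn a (q - a).

Definition lee_wt (q n : nat) (x : 'rV['Z_q]_n) : nat :=
  (\sum_(k < n) lee_wt1 (x 0%R k))%N.

Definition linear_code (q n : nat) (C : {set 'rV['Z_q]_n}) : Prop :=
  GRing.submod_closed (mem C).

(* In particular C has a nonzero codeword. *)
Definition min_lee_dist (q n : nat) (C : {set 'rV['Z_q]_n}) (d : nat) : Prop :=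
  (exists x, [/\ x \in C, x != 0 & lee_wt x = d]) /\
  (forall x, x \in C -> x != 0 -> (d <= lee_wt x)%N).

Definition max_code_size (q n d : nat) : nat :=
  (\max_(C : {set 'rV['Z_q]_n} | `[< linear_code C /\ min_lee_dist C d >])
     #|C|)%N.

(* Tuples of naturals (pi_0, ..., pi_M) with M = q./2. *)
Notation lee_tuple q := {ffun 'I_(q./2).+1 -> nat}.

Definition lee_dec (q n : nat) (x : 'rV['Z_q]_n) : lee_tuple q :=
  [ffun i : 'I_(q./2).+1 =>
     #|[set k : 'I_n | (x 0 k == i%:R) || (x 0 k == - i%:R)]|].

(* sigma_u, extended to index 0: since u is a unit, u * k = 0 forces k = 0, so
   sigma_u fixes 0. The default value of odflt is never used for a unit u
   (lee_sigmaP), and the k found is unique (lee_sigma_uniq). *)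
Definition lee_sigma (q : nat) (u : 'Z_q) (i : 'I_(q./2).+1) : 'I_(q./2).+1 :=
  odflt i [pick k : 'I_(q./2).+1 |
             (u * k%:R == i%:R) || (u * k%:R == - i%:R)].

Definition lee_act (q : nat) (u : 'Z_q) (v : lee_tuple q) : lee_tuple q :=
  [ffun i => v (lee_sigma u i)].

Definition lee_orbit (q : nat) (v : lee_tuple q) : lee_tuple q -> Prop :=
  fun w => exists2 u : 'Z_q, u \is a GRing.unit & w = lee_act u v.

(* The Krawtchouk coefficient K_w(v), computed at some a of Lee decomposition v;
   it does not depend on a, and is used only for v that are Lee decompositions,
   so the default 0 is irrelevant. The exponent is a residue mod q, read in
   {0, ..., q - 1}; z is meant to be a primitive q-th root of unity. *)
Definition krawtchouk (F : nzRingType) (z : F) (q n : nat)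
    (w v : lee_tuple q) : F :=
  if [pick a : 'rV['Z_q]_n | lee_dec a == v] is Some a
  then \sum_(x : 'rV['Z_q]_n | lee_dec x == w)
         z ^+ (\sum_(k < n) a 0 k * x 0 k)%R
  else 0.

(* The division is exact when the v i sum to n, as they do for Lee decompositions. *)
Definition lee_multinomial (q n : nat) (v : lee_tuple q) : nat :=
  (n`! %/ \prod_(i < (q./2).+1) (v i)`!)%N.

(* e is an enumeration, without repetition, of the Lee decompositions of
   (Z/qZ)^n, with (n, 0, ..., 0) first; there are D1 + 1 of them. *)
Definition lee_enum (q n D1 : nat) (e : 'I_D1.+1 -> lee_tuple q) : Prop :=
  [/\ e ord0 = [ffun i => if i == ord0 then n else 0%N],
      injective e &
      forall v, (exists i, e i = v) <-> (exists x : 'rV['Z_q]_n, lee_dec x = v)].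

(* In the last constraint <= is the order of R[i], where a <= b means that
   b - a is a nonnegative real. Krawtchouk coefficients are real (the set of x
   summed over is closed under negation), so this is the inequality in R. *)
Definition lp_feasible (R : realType) (z : R[i]) (p s n d D1 : nat)
    (e : 'I_D1.+1 -> lee_tuple (p ^ s)) (A : 'I_D1.+1 -> R) : Prop :=
  [/\ A ord0 = 1,
      (forall i, i != ord0 -> 0 <= A i) /\
      (forall i, i != ord0 ->
         (exists2 x : 'rV['Z_(p ^ s)]_n, lee_dec x = e i & (lee_wt x < d)%N) ->
         A i = 0),
      forall i j, lee_orbit (e i) (e j) -> A i = A j &
      forall j,
        - (lee_multinomial n (e j) *
             2 ^ (if p == 2 then n - e j ord0 - e j ord_max
                  else n - e j ord0))%N%:R
        <= \sum_(i | i != ord0) (A i)%:C%C * krawtchouk z n (e j) (e i)].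

Definition is_max (R : realType) (T : Type) (P : T -> Prop) (f : T -> R)
    (m : R) : Prop :=
  (exists2 t, P t & f t = m) /\ (forall t, P t -> f t <= m).

Lemma lee_pm_ex (q : nat) (a : 'Z_q) : (1 < q)%N ->
  exists k : 'I_(q./2).+1, (a == k%:R) || (a == - k%:R).
Proof.
move=> q1; have aq : (a < q)%N by rewrite -[X in (_ < X)%N](Zp_cast q1).
have [le|lt] := leqP a q./2.
  by exists (Ordinal (le : (a < (q./2).+1)%N)); rewrite /= natr_Zp eqxx.
have hk : (q - a < (q./2).+1)%N by lia.
exists (Ordinal hk) => /=; rewrite natrB; last exact: ltnW.
by rewrite natr_Zp pchar_Zp // sub0r opprK eqxx orbT.
Qed.

Lemma lee_pm_uniq (q : nat) (i k : 'I_(q./2).+1) : (1 < q)%N ->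
  (i%:R : 'Z_q) = k%:R \/ (i%:R : 'Z_q) = - k%:R -> i = k.
Proof.
move=> q1.
have hlt (m : 'I_(q./2).+1) : (m < q)%N by have := ltn_ord m; lia.
have hle (m : 'I_(q./2).+1) : (m.*2 <= q)%N by have := ltn_ord m; lia.
case=> /(congr1 val) /=; first by rewrite !val_Zp_nat // !modn_small // => /val_inj.
rewrite !val_Zp_nat // !Zp_cast // [(i %% q)%N]modn_small //.
rewrite [(k %% q)%N]modn_small //.
have [k0|k0] := posnP k.
  by rewrite k0 subn0 modnn => ik; apply/val_inj; rewrite /= ik k0.
rewrite modn_small; last by rewrite ltn_subrL k0 ltnW.
move=> ik; apply/val_inj => /=.
by have := hle i; have := hle k; have := hlt k; lia.
Qed.

Lemma lee_sigmaP (q : nat) (u : 'Z_q) (i : 'I_(q./2).+1) :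
  (1 < q)%N -> u \is a GRing.unit ->
  u * (lee_sigma u i)%:R = i%:R \/ u * (lee_sigma u i)%:R = - i%:R.
Proof.
move=> q1 Uu; rewrite /lee_sigma; case: pickP => [k /orP[]/eqP|no] //=; auto.
have [k hk] := lee_pm_ex (u^-1 * i%:R) q1.
have := no k; case/orP: hk => /eqP E.
  by rewrite -E mulVKr // eqxx.
by rewrite -[k%:R]opprK -E mulrN mulVKr // eqxx orbT.
Qed.

Lemma lee_sigma_uniq (q : nat) (u : 'Z_q) (i k : 'I_(q./2).+1) :
  (1 < q)%N -> u \is a GRing.unit ->
  u * k%:R = i%:R \/ u * k%:R = - i%:R -> lee_sigma u i = k.
Proof.
move=> q1 Uu hk; apply: (lee_pm_uniq q1).
case: (lee_sigmaP i q1 Uu) => E; case: hk => E'.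
- by left; apply: (mulrI Uu); rewrite E E'.
- by right; apply: (mulrI Uu); rewrite mulrN E E' opprK.
- by right; apply: (mulrI Uu); rewrite mulrN E E'.
- by left; apply: (mulrI Uu); rewrite E E'.
Qed.

(* Main.v *)
Require Import Defs.
From mathcomp Require Import all_boot all_order all_algebra all_fingroup.
From mathcomp Require Import boolp classical_sets reals topology normedtype.
From mathcomp Require Import derive zify ring.
Import Order.TTheory GRing.Theory Num.Theory numFieldNormedType.Exports.
Local Open Scope ring_scope.

Set Implicit Arguments.
Unset Strict Implicit.
Unset Printing Implicit Defensive.

(** The bound is Delsarte's linear programming method for the Lee scheme.

    Given a linear code C with minimum Lee distance d, let A_i be the number of
    its codewords with Lee decomposition e i. This tuple is feasible
    (code_lp_feasible) and its entries add up to #|C|. Zero is the only word of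
    decomposition (n, 0, ..., 0), which gives A_0 = 1; the Lee weight is a
    function of the Lee decomposition, so no decomposition of a word lighter
    than d occurs among the nonzero codewords; multiplication by a unit u
    permutes C and acts on decompositions by sigma_u. For the dual constraints,
    the sum of A_i K_j(i) over all i is the sum over the words y of
    decomposition e j of the character sums of z ^+ (a . y) over a in C, and
    each of them is #|C| or 0, hence nonnegative (character_sum). The term
    i = 0 is the number of words of decomposition e j, and this number is the
    multinomial coefficient times a power of 2 (card_lee_dec), so that moving it
    to the other side leaves the stated constraint.

    The maximum is attained because the feasible set is compact. It is closed,
    being cut out by linear equations and weak inequalities. It is bounded: for
    i != 0 the K_j(i) add up over j to a complete character sum, which is 0
    (sum_krawtchouk), while K_0(i) = 1; adding up the dual constraints for
    j != 0 therefore bounds the sum of the A_i from above, and the A_i are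
    nonnegative. *)

(** * Counting words of a given composition *)

Lemma card_tuple_cons (A : finType) (n : nat) (P : pred (n.+1.-tuple A)) :
  #|P| = (\sum_a #|[pred t : n.-tuple A | P (cons_tuple a t)]|)%N.
Proof.
rewrite -sum1_card (partition_big (fun t => thead t) xpredT) //=.
apply: eq_bigr => a _; rewrite -sum1_card.
rewrite (reindex (fun t : n.-tuple A => cons_tuple a t)) /=.
  by apply: eq_bigl => t; rewrite !inE theadE eqxx andbT.
exists (fun t => behead_tuple t) => t.
  by move=> _; apply: val_inj.
rewrite inE => /andP[_ /eqP <-]; rewrite [RHS]tuple_eta.
by apply: val_inj.
Qed.

(** Division-free form of the count of words with a prescribed composition: with
    g := id it says that the multinomial coefficient counts them, and a general
    g weighs each letter i by the number of its preimages. The induction removes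
    the first letter a, which lowers v (g a) by one; the resulting term is
    v (g a) times a common value, and the v j add up to n. *)
Lemma card_composition (A I : finType) (g : A -> I) (n : nat) (v : I -> nat) :
  (\sum_i v i)%N = n ->
  (#|[pred t : n.-tuple A | [forall i, count_mem i (map g t) == v i]]| *
     \prod_i (v i)`!)%N =
  (n`! * \prod_i #|[pred a | g a == i]| ^ v i)%N.
Proof.
elim: n v => [|n IH] v vn.
  have v0 i : v i = 0%N.
    by apply/eqP; move/eqP: vn; rewrite sum_nat_eq0 => /forallP/(_ i).
  under eq_bigr do rewrite v0 fact0.
  under [in RHS]eq_bigr do rewrite v0 expn0.
  rewrite !big1 // !muln1 fact0; transitivity #|{: 0.-tuple A}|; last first.
    by rewrite card_tuple.
  by apply: eq_card => t; rewrite !inE tuple0; apply/forallP => i; rewrite v0.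
(* v' j is the composition that remains once a letter of class j is removed. *)
pose v' j i := (v i - (j == i))%N.
pose c i := #|[pred a | g a == i]|.
have drop_sum j : (0 < v j)%N -> (\sum_i v' j i)%N = n.
  move=> vj; apply/eqP; rewrite -eqSS -vn -addn1.
  have <- : (\sum_i (j == i : nat))%N = 1%N.
    by rewrite (bigD1 j) //= eqxx big1 // => i /negbTE; rewrite eq_sym => ->.
  rewrite -big_split /=; apply/eqP; apply: eq_bigr => i _; rewrite /v'.
  by rewrite subnK //; case: eqP => // <-.
have drop_prod (F : I -> nat -> nat) j k :
    F j (v j) = (k * F j (v j).-1)%N ->
    (\prod_i F i (v i) = k * \prod_i F i (v' j i))%N.
  move=> Fj; rewrite (bigD1 j) // [in RHS](bigD1 j) //= /v' eqxx subn1 Fj mulnA.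
  congr (_ * _)%N; apply: eq_bigr => i /negbTE; rewrite eq_sym => ->.
  by rewrite subn0.
rewrite card_tuple_cons big_distrl /=.
rewrite (partition_big g xpredT) //=.
transitivity (\sum_i v i * (n`! * \prod_i c i ^ v i))%N; last first.
  by rewrite -big_distrl vn factS /= mulnA.
apply: eq_bigr => j _.
under eq_bigr => a /eqP gaj.
  rewrite (_ : #|_| = if (0 < v j)%N then
     #|[pred t : n.-tuple A | [forall i, count_mem i (map g t) == v' j i]]|
     else 0%N); last first.
    case: ifP => vj; last first.
      apply: eq_card0 => t; rewrite !inE; apply/negP => /forallP/(_ j) /=.
      by rewrite gaj eqxx; move: vj; case: (v j).
    apply: eq_card => t; rewrite !inE; apply: eq_forallb => i /=.
    rewrite gaj /v'; have [<-|_] := eqVneq j i; last by rewrite ?add0n ?subn0.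
    by move: vj; case: (v j) => // m _; rewrite subn1.
  over.
rewrite sum_nat_const -/(c j); case: ifPn => [vj|]; last first.
  by rewrite -eqn0Ngt => /eqP->; rewrite mul0n mul0n muln0.
rewrite (drop_prod (fun _ m => m`!) j (v j)); last by case: (v j) vj.
rewrite (drop_prod (fun i m => c i ^ m)%N j (c j)); last first.
  by case: (v j) vj => // m _; rewrite expnS.
have := IH _ (drop_sum j vj); set N := #|_|; set P := (\prod_i _)%N => IHj.
by transitivity (c j * v j * (N * P))%N; [ring | rewrite IHj; ring].
Qed.

(** * Lee classes and Lee decompositions *)

Section LeeDecomposition.
Variable q : nat.
Hypothesis q_gt1 : (1 < q)%N.
Implicit Type a b : 'Z_q.

(** The class of a modulo sign, named by its representative in 0, ..., q./2;
    this representative is the Lee weight, whence the formula. *)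
Definition lee_class a : 'I_(q./2).+1 := inord (lee_wt1 a).

Lemma val_Zq_lt a : (a < q)%N.
Proof. by rewrite -[X in (_ < X)%N](Zp_cast q_gt1). Qed.

Lemma val_lee_class a : lee_class a = lee_wt1 a :> nat.
Proof. by rewrite inordK // /lee_wt1; have := val_Zq_lt a; lia. Qed.

Lemma lee_class_nat (i : 'I_(q./2).+1) : lee_class i%:R = i.
Proof.
apply: ord_inj; rewrite val_lee_class /lee_wt1 val_Zp_nat // modn_small.
  by have := ltn_ord i; lia.
by have := ltn_ord i; lia.
Qed.

Lemma val_ZqN a : - a = ((q - a) %% q)%N :> nat.
Proof.
transitivity (((Zp_trunc q).+2 - a) %% (Zp_trunc q).+2)%N => //.
by move: (nat_of_ord a) => m; rewrite Zp_cast.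
Qed.

Lemma lee_classN a : lee_class (- a) = lee_class a.
Proof.
apply: ord_inj; rewrite !val_lee_class /lee_wt1 val_ZqN.
have := val_Zq_lt a; have [->|a0 aq] := posnP a.
  by rewrite subn0 modnn; lia.
by rewrite modn_small; lia.
Qed.

Lemma lee_classE a (i : 'I_(q./2).+1) :
  (a == i%:R) || (a == - i%:R) = (lee_class a == i).
Proof.
apply/idP/eqP => [/orP[]/eqP-> | <-]; rewrite ?lee_classN ?lee_class_nat //.
have [k /orP[]/eqP->] := lee_pm_ex a q_gt1;
  by rewrite ?lee_classN lee_class_nat eqxx ?orbT.
Qed.

Lemma lee_class_eqP a b : lee_class a = lee_class b -> a = b \/ a = - b.
Proof.
move=> ab; have : lee_class a == lee_class b by rewrite ab.
have : lee_class b == lee_class b by [].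
rewrite -!lee_classE; set c := _%:R.
by move=> /orP[]/eqP-> /orP[]/eqP->; rewrite ?opprK; auto.
Qed.

Section Words.
Variable n : nat.
Implicit Type x y : 'rV['Z_q]_n.

Definition lee_classes x : n.-tuple 'I_(q./2).+1 :=
  [tuple lee_class (x 0 k) | k < n].

Lemma lee_decE x i : lee_dec x i = #|[set k | lee_class (x 0 k) == i]|.
Proof.
by rewrite ffunE; apply: eq_card => k; rewrite !inE lee_classE.
Qed.

Lemma lee_dec_count x i : lee_dec x i = count_mem i (lee_classes x).
Proof.
rewrite lee_decE cardE size_filter -enumT /= count_map.
by apply: eq_count => k; rewrite !inE.
Qed.

Lemma sum_lee_dec x : (\sum_i lee_dec x i)%N = n.
Proof.
rewrite -[RHS]card_ord -sum1_card.
rewrite (partition_big (fun k => lee_class (x 0 k)) xpredT) //.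
by apply: eq_bigr => i _; rewrite lee_decE -sum1dep_card.
Qed.

Lemma lee_wt_dec x : lee_wt x = (\sum_(i < (q./2).+1) i * lee_dec x i)%N.
Proof.
rewrite /lee_wt (partition_big (fun k => lee_class (x 0 k)) xpredT) //.
apply: eq_bigr => i _; rewrite lee_decE -sum1dep_card big_distrr /=.
by apply: eq_bigr => k /eqP <-; rewrite val_lee_class muln1.
Qed.

Lemma lee_class0P a : (lee_class a == ord0) = (a == 0).
Proof. by rewrite -lee_classE oppr0 orbb. Qed.

Lemma lee_dec_eq0 x :
  (lee_dec x == [ffun i => if i == ord0 then n else 0%N]) = (x == 0).
Proof.
apply/eqP/eqP => [/ffunP/(_ ord0)|->].
  rewrite lee_decE ffunE eqxx => xn; apply/rowP => k; rewrite mxE.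
  apply/eqP; rewrite -lee_class0P.
  have /eqP/setP/(_ k) : [set k | lee_class (x 0 k) == ord0] == [set: 'I_n].
    by rewrite eqEcard finset.subsetT cardsT card_ord xn leqnn.
  by rewrite !inE.
apply/ffunP => i; rewrite lee_decE ffunE eq_sym; case: ifP => i0.
  rewrite -[RHS]card_ord -cardsT; apply: eq_card => k; rewrite !inE mxE.
  by rewrite (eqP (_ : lee_class 0 == ord0)) ?lee_class0P // eq_sym.
apply: eq_card0 => k; rewrite !inE mxE.
by rewrite (eqP (_ : lee_class 0 == ord0)) ?lee_class0P // eq_sym.
Qed.

Lemma lee_dec_scale (u : 'Z_q) x :
  u \is a GRing.unit -> lee_dec (u *: x) = lee_act u (lee_dec x).
Proof.
move=> Uu; apply/ffunP => i; rewrite lee_decE ffunE lee_decE.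
apply: eq_card => k; rewrite !inE mxE -!lee_classE.
have [<-|E] := lee_sigmaP i q_gt1 Uu.
  by rewrite -!mulrN !(inj_eq (mulrI Uu)).
have -> : i%:R = - (u * (lee_sigma u i)%:R) :> 'Z_q by rewrite E opprK.
by rewrite opprK -!mulrN !(inj_eq (mulrI Uu)) orbC.
Qed.

(** The Lee decomposition is the composition of the word of classes, so it
    determines a word up to a permutation of the coordinates and signs. *)
Lemma lee_dec_eq_perm x y : lee_dec x = lee_dec y ->
  exists s : 'S_n, forall k, lee_class (y 0 k) = lee_class (x 0 (s k)).
Proof.
move=> xy; have : perm_eq (lee_classes y) (lee_classes x).
  by apply/allP => i _ /=; rewrite -!lee_dec_count xy.
move=> /tuple_permP[s /val_inj ys]; exists s => k.
by have := congr1 (fun t => tnth t k) ys; rewrite !tnth_mktuple.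
Qed.
(** This is card_composition for lee_class; with g := id the same lemma shows
    that the division in lee_multinomial is exact. *)
Lemma card_lee_dec_multinomial x :
  #|[pred y : 'rV['Z_q]_n | lee_dec y == lee_dec x]| =
  (lee_multinomial n (lee_dec x) *
     \prod_i #|[pred a | lee_class a == i]| ^ lee_dec x i)%N.
Proof.
set v := lee_dec x; have vn := sum_lee_dec x.
have prod_gt0 : (0 < \prod_i (v i)`!)%N.
  by apply: prodn_gt0 => i; rewrite fact_gt0.
have /(congr1 (dvdn (\prod_i (v i)`!)%N)) := card_composition id vn.
rewrite dvdn_mull // [X in (n`! * X)%N]big1 => [|i _]; last first.
  by rewrite (eq_card1 (x := i)) ?exp1n // => a; rewrite !inE.
rewrite muln1 => /esym dvd_fact.
have := card_composition lee_class vn; rewrite /lee_multinomial.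
rewrite -{1}(divnK dvd_fact) mulnAC => /eqP; rewrite eqn_pmul2r // => /eqP <-.
rewrite -!sum1_card.
rewrite (reindex (fun t : n.-tuple 'Z_q => \row_k tnth t k)) /=; last first.
  exists (fun y : 'rV_n => [tuple y 0 k | k < n]) => [t _|y _].
    by apply: eq_from_tnth => k; rewrite tnth_mktuple mxE.
  by apply/rowP => k; rewrite mxE tnth_mktuple.
apply: eq_bigl => t; rewrite !inE.
have classes_row : lee_classes (\row_k tnth t k) = map lee_class t :> seq _.
  rewrite -[in RHS](map_tnth_enum t) -map_comp.
  by apply: eq_map => k /=; rewrite mxE.
apply/eqP/forallP => [E i | E].
  by rewrite -classes_row -lee_dec_count E.
by apply/ffunP => i; rewrite lee_dec_count classes_row; apply/eqP.
Qed.
End Words.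

Lemma lee_class_selfopp (i : 'I_(q./2).+1) :
  (i%:R == - i%:R :> 'Z_q) = (i == ord0) || (i.*2 == q).
Proof.
rewrite -addr_eq0 -natrD addnn -[i == ord0]val_eqE /=.
have -> : (i.*2%:R == 0 :> 'Z_q) = (i.*2 %% q == 0)%N.
  by rewrite -(val_Zp_nat q_gt1).
have := ltn_ord i => iM.
have [->|] := eqVneq i.*2 q; first by rewrite modnn orbT.
by move=> i2q; rewrite modn_small ?double_eq0 ?orbF //; lia.
Qed.

(** A class is a pair of opposite residues, which collapses to one residue for
    0 and, when q is even, for q / 2. *)
Lemma card_lee_class (i : 'I_(q./2).+1) :
  #|[pred a | lee_class a == i]| =
  (if (i == ord0) || (i.*2 == q) then 1 else 2)%N.
Proof.
rewrite -lee_class_selfopp (eq_card (B := pred2 i%:R (- i%:R))).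
  by rewrite card2; case: eqP.
by move=> a; rewrite !inE -lee_classE.
Qed.

Lemma card_lee_dec n (x : 'rV['Z_q]_n) :
  let v := lee_dec x in
  #|[pred y : 'rV['Z_q]_n | lee_dec y == v]| =
  (lee_multinomial n v *
     2 ^ (if odd q then n - v ord0 else n - v ord0 - v ord_max))%N.
Proof.
move=> v; rewrite card_lee_dec_multinomial -/v; congr (_ * _)%N.
under eq_bigr do rewrite card_lee_class.
rewrite -(sum_lee_dec x) -/v (bigD1 ord0) //= [in RHS](bigD1 ord0) //=.
rewrite exp1n mul1n addKn; case: ifP => q_odd.
  rewrite expn_sum; apply: eq_bigr => i /negbTE ->.
  by case: eqP => // /(congr1 odd); rewrite odd_double q_odd.
have max0 : (ord_max : 'I_(q./2).+1) != ord0 by rewrite -val_eqE /=; lia.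
rewrite (bigD1 ord_max) //= [in RHS](bigD1 ord_max) //= addKn.
rewrite even_halfK ?q_odd // eqxx orbT exp1n mul1n expn_sum.
apply: eq_bigr => i /andP[/negbTE -> imax].
case: eqP => // /(congr1 half); rewrite doubleK => iq.
by case/eqP: imax; apply: val_inj.
Qed.
End LeeDecomposition.

(** * Character sums and Krawtchouk coefficients *)

Section Characters.
Variables (q n : nat).
Hypothesis q_gt1 : (1 < q)%N.
Implicit Types (a b x y : 'rV['Z_q]_n) (C : {set 'rV['Z_q]_n}).

(** The bilinear form in the exponents of the Krawtchouk coefficients; the maps
    x |-> z ^+ dot a x are the characters of the group of words. *)
Definition dot a x : 'Z_q := \sum_(k < n) a 0 k * x 0 k.

Lemma dotDl a b x : dot (a + b) x = dot a x + dot b x.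
Proof. by rewrite -big_split; apply: eq_bigr => k _; rewrite mxE mulrDl. Qed.

Lemma dotC a x : dot a x = dot x a.
Proof. by apply: eq_bigr => k _; rewrite mulrC. Qed.

Section IntegralDomain.
Variables (F : idomainType) (z : F).
Hypothesis z_prim : q.-primitive_root z.

Lemma expr_ZqD (s t : 'Z_q) : z ^+ (s + t)%R = z ^+ s * z ^+ t.
Proof.
rewrite -exprD -(prim_expr_mod z_prim (s + t)); congr (z ^+ _) => /=.
by move: (nat_of_ord s) (nat_of_ord t) => m1 m2; rewrite Zp_cast.
Qed.

Lemma expr_Zq_eq1 (t : 'Z_q) : (z ^+ t == 1) = (t == 0).
Proof.
rewrite -(prim_order_dvd z_prim) /dvdn modn_small //.
exact: val_Zq_lt.
Qed.

(** If dot b x != 0 for some b in C, then translating C by b multiplies the sum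
    by z ^+ dot b x, which is not 1 as z is primitive; so the sum is 0. *)
Lemma character_sum C x : linear_code C ->
  \sum_(a in C) z ^+ dot a x =
    if [forall a in C, dot a x == 0] then #|C|%:R else 0.
Proof.
move=> [_ Cclosed]; case: ifPn => [/forall_inP Cx|].
  by rewrite (eq_bigr (fun=> 1)) ?sumr_const // => a /Cx/eqP->.
rewrite negb_forall_in => /exists_inP[b bC bx].
have C_shift a : (b + a \in C) = (a \in C).
  apply/idP/idP => aC; last by rewrite -[b]scale1r; apply: Cclosed.
  by rewrite -[a](addKr b) -scaleN1r; apply: Cclosed.
set S := \sum_(a in C) _.
have S_shift : z ^+ dot b x * S = S.
  rewrite {2}/S (reindex_inj (addrI b)) /= (eq_bigl _ _ C_shift) big_distrr.
  by apply: eq_bigr => a _; rewrite dotDl expr_ZqD.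
have /eqP : (z ^+ dot b x - 1) * S = 0 by rewrite mulrBl mul1r S_shift subrr.
by rewrite mulf_eq0 subr_eq0 expr_Zq_eq1 (negbTE bx) /= => /eqP.
Qed.

Lemma character_sum_full a : a != 0 ->
  \sum_(x : 'rV['Z_q]_n) z ^+ dot a x = 0.
Proof.
move=> a0; transitivity (\sum_(x in [set: 'rV['Z_q]_n]) z ^+ dot x a).
  by apply: eq_big => x; rewrite ?inE // dotC.
rewrite character_sum; last by split=> [|c u v]; rewrite !inE.
case: ifP => // /forall_inP zero; case/eqP: a0; apply/rowP => k.
rewrite [RHS]mxE -(eqP (zero (delta_mx 0 k) (finset.in_setT _))).
rewrite /dot (bigD1 k) //= big1 ?addr0 => [|i ik].
  by rewrite mxE !eqxx mul1r.
by rewrite mxE (negbTE ik) mul0r.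
Qed.

(** Independence of a Krawtchouk coefficient from the chosen word: b comes from
    a by a permutation of coordinates and sign changes, and the same operation
    h on x preserves both the Lee decomposition of x and the bilinear form. *)
Lemma krawtchouk_sum_dec_eq (w : lee_tuple q) a b : lee_dec a = lee_dec b ->
  \sum_(x | lee_dec x == w) z ^+ dot a x =
  \sum_(x | lee_dec x == w) z ^+ dot b x.
Proof.
move=> /(lee_dec_eq_perm q_gt1)[s bs].
pose sg k : 'Z_q := if b 0 k == a 0 (s k) then 1 else -1.
have sg_sq k : sg k * sg k = 1.
  by rewrite /sg; case: ifP => _; rewrite ?mulrNN mulr1.
have bE k : b 0 k = sg k * a 0 (s k).
  rewrite /sg; case: eqP => [->|]; first by rewrite mul1r.
  by case: (lee_class_eqP q_gt1 (bs k)) => // ->; rewrite mulN1r.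
pose h x := \row_k (sg k * x 0 (s k)).
have h_inj : injective h.
  move=> x y /rowP xy; apply/rowP => k; have := xy (s^-1 k)%g.
  rewrite !mxE permKV => /(congr1 ( *%R (sg (s^-1 k)%g))).
  by rewrite !mulrA sg_sq !mul1r.
rewrite [RHS](reindex_inj h_inj) /=; apply: eq_big => [x|x _].
  congr (_ == _); apply/ffunP => i; rewrite !lee_decE //.
  rewrite -(card_imset _ (@perm_inj _ s^-1)); apply: eq_card => k.
  rewrite -[k in LHS](permK s) mem_imset ?inE; last exact: perm_inj.
  rewrite mxE /sg; case: ifP => _; first by rewrite mul1r.
  by rewrite mulN1r lee_classN.
congr (z ^+ _); rewrite /dot (reindex_inj (@perm_inj _ s)).
congr (nat_of_ord _).
by apply: eq_bigr => k _; rewrite mxE bE mulrACA sg_sq mul1r.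
Qed.

Lemma krawtchoukE (w : lee_tuple q) a :
  krawtchouk z n w (lee_dec a) = \sum_(x | lee_dec x == w) z ^+ dot a x.
Proof.
rewrite /krawtchouk; case: pickP => [b /eqP ba|/(_ a)]; last by rewrite eqxx.
by rewrite -(krawtchouk_sum_dec_eq w ba).
Qed.
End IntegralDomain.
End Characters.

(** * Maximizing a sum over a compact feasible set *)

Section LinearProgram.
Local Open Scope classical_set_scope.
Variable R : realType.

Lemma linear_form_continuous (N : nat) (Q : pred 'I_N) (c : 'I_N -> R) :
  continuous (fun v : 'rV[R]_N => \sum_(i | Q i) v 0 i * c i).
Proof.
have coordc i : continuous (fun v : 'rV[R]_N => v 0 i).
  exact: coord_continuous.
have coordM i : continuous (fun v : 'rV[R]_N => v 0 i * c i).
  by move=> v; apply: (@cvgMr_tmp _ _ (nbhs v)); exact: coordc.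
by apply: continuous_big => [|i _]; [exact: add_continuous | exact: coordM].
Qed.

(** The tuples are viewed as row vectors, because those carry the topology in
    which bounded closed sets are compact. *)
Lemma sum_max_exists (N : nat) (P : ('I_N -> R) -> Prop) (B : R) :
  (exists A, P A) -> (forall A, P A -> forall i, `|A i| <= B) ->
  closed [set v : 'rV[R]_N | P (v 0)] ->
  exists m, is_max P (fun A => \sum_i A i) m.
Proof.
move=> [A0 PA0] PB Pclosed.
have row_app (A : 'I_N -> R) : (\row_i A i) 0 = A.
  by apply/funext => i; rewrite mxE.
have Pcompact : compact [set v : 'rV[R]_N | P (v 0)].
  apply: bounded_closed_compact => //; exists (Num.max B 0).
  split=> [|M BM v /PB vB]; first exact: num_real.
  have [M0 M0'] : B <= M /\ 0 <= M.
    by split; apply: le_trans (ltW BM); rewrite le_max lexx ?orbT.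
  rewrite /Num.norm /= mx_normrE; apply/bigmax_leP; split=> // -[i j] _ /=.
  by rewrite (ord1 i); apply: le_trans (vB j) _.
have [||v vP vmax] := compact_EVT_max (f := fun v : 'rV[R]_N => \sum_i v 0 i)
    _ Pcompact.
- by exists (\row_i A0 i); rewrite /= row_app.
- apply: continuous_subspaceT ; apply: continuous_big => [|i _].
    exact: add_continuous.
  exact: (@coord_continuous R 1 N 0 i).
exists (\sum_i v 0 i); split=> [|A PA].
  by exists (v 0) => //; exact: set_mem vP.
have := vmax (\row_i A i); rewrite row_app; apply.
by apply/mem_set; rewrite /= row_app.
Qed.

Lemma closed_and (T : topologicalType) (P Q : T -> Prop) :
  closed [set v | P v] -> closed [set v | Q v] -> closed [set v | P v /\ Q v].
Proof. exact: closedI. Qed.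

Lemma closed_forall (T : topologicalType) (J : Type) (P : J -> T -> Prop) :
  (forall j, closed [set v | P j v]) -> closed [set v | forall j, P j v].
Proof.
move=> Pc.
have := @closed_bigI T J setT (fun j => [set v | P j v]) (fun j _ => Pc j).
congr (closed _); apply/seteqP; split=> v H j; first exact: H.
by move=> _; exact: H.
Qed.

Lemma ReC_sum (I : Type) (r : seq I) (Q : pred I) (A : I -> R) (k : I -> R[i]) :
  complex.Re (\sum_(i <- r | Q i) (A i)%:C%C * k i) =
  \sum_(i <- r | Q i) A i * complex.Re (k i).
Proof.
rewrite (big_morph (@complex.Re R) (id1 := 0) (op1 := +%R)) //; last first.
  by case=> ? ? [].
by apply: eq_bigr => i _; case: (k i) => a b /=; rewrite mul0r subr0.
Qed.

Lemma ImC_sum (I : Type) (r : seq I) (Q : pred I) (A : I -> R) (k : I -> R[i]) :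
  complex.Im (\sum_(i <- r | Q i) (A i)%:C%C * k i) =
  \sum_(i <- r | Q i) A i * complex.Im (k i).
Proof.
rewrite (big_morph (@complex.Im R) (id1 := 0) (op1 := +%R)) //; last first.
  by case=> ? ? [].
by apply: eq_bigr => i _; case: (k i) => a b /=; rewrite mul0r addr0.
Qed.

(** An inequality in R[i] amounts to a linear equation between imaginary parts
    and a linear inequality between real parts; both are closed conditions. *)
Lemma closed_complex_le (N : nat) (Q : pred 'I_N) (c : R[i])
    (k : 'I_N -> R[i]) :
  closed [set v : 'rV[R]_N | c <= \sum_(i | Q i) (v 0 i)%:C%C * k i].
Proof.
pose f v := \sum_(i | Q i) (v : 'rV[R]_N) 0 i * complex.Re (k i).
pose g v := \sum_(i | Q i) (v : 'rV[R]_N) 0 i * complex.Im (k i).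
rewrite (_ : mkset _ =
    g @^-1` [set complex.Im c] `&` f @^-1` [set t | complex.Re c <= t]).
  apply: closedI; apply: preimage_closed.
  - by move=> v _; exact: linear_form_continuous.
  - exact: closed_eq.
  - by move=> v _; exact: linear_form_continuous.
  - exact: closed_ge.
apply/seteqP; split => v /=; rewrite lecE ReC_sum ImC_sum.
  by move=> /andP[/eqP].
by rewrite /g /f => -[-> ->]; rewrite eqxx.
Qed.

(** Each constraint is an equation or a weak inequality between continuous
    functions; the premises in the constraints do not mention A, so they only
    select which of these closed conditions are imposed. *)
Lemma lp_feasible_closed (p s n d D1 : nat) (z : R[i])
    (e : 'I_D1.+1 -> lee_tuple (p ^ s)) :
  closed [set v : 'rV[R]_D1.+1 | lp_feasible z n d e (v 0)].
Proof.
have closed_coord i (S : set R) : closed S ->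
    closed [set v : 'rV[R]_D1.+1 | S (v 0 i)].
  by apply: preimage_closed => v _; exact: coord_continuous.
rewrite (_ : mkset _ = [set v : 'rV[R]_D1.+1 |
   (v 0 ord0 = 1 /\
    ((forall i, i != ord0 -> 0 <= v 0 i) /\
     (forall i, i != ord0 ->
        (exists2 x : 'rV['Z_(p ^ s)]_n, lee_dec x = e i & (lee_wt x < d)%N) ->
        v 0 i = 0))) /\
   ((forall i j, lee_orbit (e i) (e j) -> v 0 i = v 0 j) /\
    (forall j,
        - (lee_multinomial n (e j) *
             2 ^ (if p == 2 then n - e j ord0 - e j ord_max
                  else n - e j ord0))%N%:R
        <= \sum_(i | i != ord0) (v 0 i)%:C%C * krawtchouk z n (e j) (e i)))]).
  apply: closed_and; apply: closed_and.
  - exact: (closed_coord _ [set 1] (@closed_eq _ _)).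
  - apply: closed_and; do !apply: closed_forall => ?.
      exact: (closed_coord _ [set t | 0 <= t] (@closed_ge _ _)).
    exact: (closed_coord _ [set 0] (@closed_eq _ _)).
  - apply: closed_forall => i; apply: closed_forall => j.
    apply: closed_forall => _.
    rewrite (_ : mkset _ =
        (fun v : 'rV[R]_D1.+1 => v 0 i - v 0 j) @^-1` [set 0]).
      apply: preimage_closed; last exact: closed_eq.
      by move=> v _; apply: continuousB; exact: coord_continuous.
    by apply/seteqP; split=> v /= => [->|/subr0_eq //]; rewrite subrr.
  - by apply: closed_forall => j; exact: closed_complex_le.
by apply/seteqP; split=> v /= => [[? ? ? ?]|[[? ?] [? ?]]]; split.
Qed.
End LinearProgram.

(** * The Lee distribution of a code *)

Section LeeProgram.
Variables (R : realType) (p s n d D1 : nat) (z : R[i]).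
Variable e : 'I_D1.+1 -> lee_tuple (p ^ s).
Hypotheses (p_prime : prime p) (s_gt0 : (0 < s)%N).
Hypothesis z_prim : (p ^ s)%N.-primitive_root z.
Hypothesis e_enum : lee_enum n e.
Local Notation word := 'rV['Z_(p ^ s)]_n.
Implicit Types (x : word) (C : {set word}).

Let q_gt1 : (1 < p ^ s)%N.
Proof. by rewrite -(exp1n s) ltn_exp2r ?prime_gt1. Qed.

(** This closed formula, whose opposite bounds the dual constraint for j, counts
    the words of decomposition e j (lee_count_card). *)
Definition lee_count j : nat :=
  (lee_multinomial n (e j) *
     2 ^ (if p == 2 then n - e j ord0 - e j ord_max else n - e j ord0))%N.

Lemma lee_enum_word i : exists x, lee_dec x = e i.
Proof. by case: e_enum => _ _ /(_ (e i))[+ _]; apply; exists i. Qed.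

Lemma lee_count_card j : #|[pred x : word | lee_dec x == e j]| = lee_count j.
Proof.
have [x xj] := lee_enum_word j; rewrite /lee_count -xj card_lee_dec //.
rewrite oddX gtn_eqF //=.
have -> : (p == 2) = ~~ odd p; last by case: (odd p).
by apply/eqP/idP => [->//|]; case: (even_prime p_prime) => // ->.
Qed.

Lemma lee_dec_ord0 x : (lee_dec x == e ord0) = (x == 0).
Proof. by case: e_enum => -> _ _; rewrite lee_dec_eq0. Qed.

(** Every word has exactly one Lee decomposition in the enumeration, so sums
    over words can be split along it. *)
Lemma sum_lee_enum (V : nmodType) (Q : pred word) (f : word -> V) :
  \sum_j \sum_(x | Q x && (lee_dec x == e j)) f x = \sum_(x | Q x) f x.
Proof.
case: e_enum => _ e_inj e_dec.
pose idx x := odflt ord0 [pick j | lee_dec x == e j].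
have idxP x j : (lee_dec x == e j) = (idx x == j).
  rewrite /idx; case: pickP => [k /eqP-> | none] /=; first exact: inj_eq.
  have [_ /(_ (ex_intro _ x erefl))[k kx]] := e_dec (lee_dec x).
  by have := none k; rewrite kx eqxx.
rewrite [RHS](partition_big idx xpredT) //=.
by apply: eq_bigr => j _; apply: eq_bigl => x; rewrite idxP.
Qed.

Lemma krawtchouk_e j x :
  krawtchouk z n (e j) (lee_dec x) = \sum_(y | lee_dec y == e j) z ^+ dot x y.
Proof. exact: krawtchoukE. Qed.

Lemma krawtchouk_row0 i : krawtchouk z n (e ord0) (e i) = 1.
Proof.
have [x <-] := lee_enum_word i; rewrite krawtchouk_e.
rewrite (eq_bigl _ _ lee_dec_ord0) big_pred1_eq.
by rewrite /dot big1 // => k _; rewrite mxE mulr0.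
Qed.

Lemma krawtchouk_col0 j : krawtchouk z n (e j) (e ord0) = (lee_count j)%:R.
Proof.
have /eqP <- : lee_dec (0 : word) == e ord0 by rewrite lee_dec_ord0.
rewrite krawtchouk_e -lee_count_card -sumr_const; apply: eq_bigr => y _.
by rewrite /dot big1 // => k _; rewrite mxE mul0r.
Qed.

(** The classes of decompositions cover all words, so this is the complete sum
    of a nontrivial character. *)
Lemma sum_krawtchouk i : i != ord0 ->
  \sum_j krawtchouk z n (e j) (e i) = 0.
Proof.
move=> i0; have [x xi] := lee_enum_word i.
have x0 : x != 0.
  rewrite -lee_dec_ord0 xi; case: e_enum => _ e_inj _.
  by rewrite (inj_eq e_inj).
rewrite -[RHS](character_sum_full q_gt1 z_prim x0).
rewrite -[RHS](sum_lee_enum xpredT) -xi.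
by apply: eq_bigr => j _; exact: krawtchouk_e.
Qed.

(** The double sum of A_i K_j(i) over all j and all i != 0 vanishes by
    sum_krawtchouk. Its part j = 0 is the sum of the A_i with i != 0, and
    the constraints bound every other part from below. *)
Lemma lp_feasible_sum_le A : lp_feasible z n d e A ->
  \sum_i A i <= (\sum_j lee_count j)%N%:R.
Proof.
move=> [A0 _ _ dual].
have : \sum_j \sum_(i | i != ord0) (A i)%:C%C * krawtchouk z n (e j) (e i) = 0.
  rewrite exchange_big big1 //= => i i0.
  by rewrite -big_distrr /= sum_krawtchouk ?mulr0.
rewrite (bigD1 ord0) //=.
under eq_bigr do rewrite krawtchouk_row0 mulr1.
move=> /eqP; rewrite addr_eq0 => /eqP sumA.
have count0 : lee_count ord0 = 1%N.
  by rewrite -lee_count_card (eq_card lee_dec_ord0) card1.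
rewrite (bigD1 ord0) //= [in leRHS](bigD1 ord0) //= A0 count0 natrD lerD2l.
rewrite -lecR rmorph_sum /= sumA rmorph_nat natr_sum -sumrN.
apply: ler_sum => j _.
by rewrite lerNl; exact: dual.
Qed.

Lemma lp_feasible_bounded :
  exists B : R, forall A, lp_feasible z n d e A -> forall i, `|A i| <= B.
Proof.
exists (\sum_j lee_count j)%N%:R => A Afeas i.
case: (Afeas) => A0 [A_ge0 _] _ _.
have A_nneg k : 0 <= A k by have [->|/A_ge0//] := eqVneq k ord0; rewrite A0.
rewrite ger0_norm //; apply: le_trans (lp_feasible_sum_le Afeas).
by rewrite (bigD1 i) //= lerDl sumr_ge0.
Qed.

Definition code_lee_distribution C (i : 'I_D1.+1) : R :=
  #|[set x in C | lee_dec x == e i]|%:R.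

Lemma sum_code_lee_distribution C :
  \sum_i code_lee_distribution C i = #|C|%:R.
Proof.
rewrite -[RHS]sumr_const -[RHS](sum_lee_enum (mem C)).
apply: eq_bigr => i _; rewrite /code_lee_distribution -sumr_const.
by apply: eq_bigl => x; rewrite inE.
Qed.

(** Multiplication by u is a bijection from the codewords of decomposition e i
    to those of decomposition e j; the inverse is multiplication by u^-1. *)
Lemma code_lee_distribution_orbit C i j : linear_code C ->
  lee_orbit (e i) (e j) ->
  code_lee_distribution C i = code_lee_distribution C j.
Proof.
move=> [C0 Cclosed] [u Uu ej]; congr (_%:R).
have CZ v x : x \in C -> v *: x \in C.
  by move=> xC; rewrite -[v *: x]addr0; apply: Cclosed.
have scaleuK x : u^-1 *: (u *: x) = x by rewrite scalerA mulVr // scale1r.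
have [y yi] := lee_enum_word i.
rewrite -!sum1_card [RHS](reindex_inj (can_inj scaleuK)) /=.
apply: eq_bigl => x; rewrite !inE; congr (_ && _).
  apply/idP/idP => [|uxC]; first exact: CZ.
  by rewrite -[x]scaleuK; exact: CZ.
rewrite ej lee_dec_scale //; apply/eqP/eqP => [->//|act_eq].
rewrite -[x]scaleuK lee_dec_scale ?unitrV // lee_dec_scale // act_eq.
by rewrite -yi -!lee_dec_scale ?unitrV // scaleuK.
Qed.

(** Unfolding the distribution and the coefficients gives a double sum over the
    codewords x and the words y of decomposition e j; for fixed y the sum over
    x is a character sum over C, which is 0 or #|C|. *)
Lemma code_lee_distribution_dual C j : linear_code C ->
  0 <= \sum_i (code_lee_distribution C i)%:C%C * krawtchouk z n (e j) (e i).
Proof.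
move=> Clin.
rewrite (eq_bigr (fun i => \sum_(x | (x \in C) && (lee_dec x == e i))
    \sum_(y | lee_dec y == e j) z ^+ dot x y)).
  rewrite (sum_lee_enum (mem C)) exchange_big /=; apply: sumr_ge0 => y _.
  by rewrite (character_sum q_gt1 z_prim) //; case: ifP => // _; exact: ler0n.
move=> i _; rewrite rmorph_nat mulr_natl -sumr_const.
apply: eq_big => [x|x]; rewrite inE // => /andP[_ /eqP <-].
exact: krawtchouk_e.
Qed.

Lemma code_lp_feasible C : linear_code C -> min_lee_dist C d ->
  lp_feasible z n d e (code_lee_distribution C).
Proof.
move=> Clin [_ Cmin].
have A0 : code_lee_distribution C ord0 = 1.
  rewrite /code_lee_distribution (_ : [set _ in _ | _] = [set 0]) ?cards1 //.
  apply/setP => x; rewrite !inE lee_dec_ord0.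
  case: eqP => [->|]; last by rewrite andbF.
  by case: Clin => ->.
split=> //; first split=> [i _|i i0 [x xi xd]].
- exact: ler0n.
- rewrite /code_lee_distribution.
  rewrite (_ : [set _ in _ | _] = finset.set0) ?cards0 //.
  apply/setP => y; rewrite !inE; apply/negP => /andP[yC /eqP yi].
  have y0 : y != 0.
    rewrite -lee_dec_ord0 yi; case: e_enum => _ e_inj _.
    by rewrite (inj_eq e_inj).
  have := Cmin y yC y0; rewrite leqNgt => /negP; apply.
  by rewrite lee_wt_dec // yi -xi -lee_wt_dec.
- by move=> i j; exact: code_lee_distribution_orbit.
- move=> j; have := code_lee_distribution_dual j Clin.
  rewrite (bigD1 ord0) //= A0 mul1r krawtchouk_col0.
  by rewrite -lerBlDl sub0r.
Qed.

End LeeProgram.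

Theorem theorem37 (R : realType) (p s n d D1 : nat) (z : R[i])
    (e : 'I_D1.+1 -> lee_tuple (p ^ s)) :
  prime p -> (0 < s)%N -> (0 < n)%N ->
  (p ^ s)%N.-primitive_root z ->
  lee_enum n e ->
  (exists C : {set 'rV['Z_(p ^ s)]_n}, linear_code C /\ min_lee_dist C d) ->
  exists2 m : R,
    is_max (lp_feasible z n d e) (fun A => \sum_(i < D1.+1) A i) m &
    (max_code_size (p ^ s) n d)%:R <= m.
Proof.
move=> p_prime s_gt0 _ z_prim e_enum [C0 [C0lin C0min]].
have feas C := @code_lp_feasible R p s n d D1 z e p_prime s_gt0 z_prim e_enum C.
have [B Bbound] := lp_feasible_bounded d p_prime s_gt0 z_prim e_enum.
have feas_closed := @lp_feasible_closed R p s n d D1 z e.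
have [|m m_max] := sum_max_exists _ Bbound feas_closed.
  by exists (code_lee_distribution R e C0); exact: feas.
exists m => //; rewrite /max_code_size.
have [C /asboolP[Clin Cmin] ->] := @eq_bigmax_cond _
  (fun C : {set 'rV['Z_(p ^ s)]_n} => `[< linear_code C /\ min_lee_dist C d >])
  (fun C => #|C|) (ltac:(by apply/card_gt0P; exists C0; apply/asboolP)).
rewrite -(sum_code_lee_distribution R e_enum).
by case: m_max => _; apply; exact: feas.
Qed.
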